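(* Let $(\mathscr B,\otimes,\mathbf 1)$ be an abelian monoidal category with right exact tensor product such that: (a) for all $X,Z\in\mathscr B$, the functor $\mathrm{Hom}(X\otimes-,Z)$ is representable by an object $\underline{\mathrm{Hom}}(X,Z)\in\mathscr B$; (b) every object in $\mathscr B$ is a quotient of a left flat one; (c) there are a set $S$ and, for each $\alpha\in S$, an inverse system in $\mathscr B$ with codirected poset $I_\alpha$ and left flat objects $\{P^\alpha_i\mid i\in I_\alpha\}$, such that the functors $F_\alpha:=\varinjlim_i\mathrm{Hom}(P_i^\alpha,-):\mathscr B\to\mathrm{Ab}$ are exact and jointly faithful. If for an exact sequence $0\to X\to Y\to Z\to0$ in $\mathscr B$ both $X$ and $Z$ are right rigid, then so is $Y$.
   Context: An object $X$ of $\mathscr B$ is left flat if the functor $-\otimes X$ is exact. An object $X$ is right rigid if it has a right dual ${}^*X$, i.e. an object with an evaluation $X\otimes{}^*X\to\mathbf 1$ and a coevaluation $\mathbf 1\to{}^*X\otimes X$ satisfying the usual zig-zag identities. $\mathrm{Ab}$ is the category of abelian groups. *)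

(* Defs.v *)
From HB Require Import structures.
From mathcomp Require Import all_boot all_order all_algebra.
From mathcomp Require Import boolp.

Set Implicit Arguments.
Unset Strict Implicit.
Unset Printing Implicit Defensive.

Import GRing.Theory.
Local Open Scope ring_scope.
Local Open Scope quotient_scope.

Declare Scope cat_scope.
Delimit Scope cat_scope with cat.
Local Open Scope cat_scope.

Record preadditive := Preadditive {
  obj :> Type;
  Mor : obj -> obj -> zmodType;
  idm : forall X, Mor X X;
  cmp : forall X Y Z, Mor Y Z -> Mor X Y -> Mor X Z;
  cmpA : forall X Y Z W (h : Mor Z W) (g : Mor Y Z) (f : Mor X Y),
    cmp h (cmp g f) = cmp (cmp h g) f;
  cmp1m : forall X Y (f : Mor X Y), cmp (idm Y) f = f;
  cmpm1 : forall X Y (f : Mor X Y), cmp f (idm X) = f;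
  cmpDl : forall X Y Z (g h : Mor Y Z) (f : Mor X Y),
    cmp (g + h) f = cmp g f + cmp h f;
  cmpDr : forall X Y Z (g : Mor Y Z) (f h : Mor X Y),
    cmp g (f + h) = cmp g f + cmp g h
}.

Arguments Mor {p} X Y.
Arguments idm {p} X.
Arguments cmp {p X Y Z} g f.

(* [g ∘ f] is "g after f". *)
Notation "g ∘ f" := (cmp g f) (at level 40, left associativity) : cat_scope.

Section Abelian.
Variable C : preadditive.

Lemma cmp0m (U V W : C) (f : Mor U V) : (0 : Mor V W) ∘ f = 0.
Proof. by apply: (addIr (0 ∘ f)); rewrite -cmpDl !add0r. Qed.

Lemma cmpm0 (U V W : C) (f : Mor V W) : f ∘ (0 : Mor U V) = 0.
Proof. by apply: (addIr (f ∘ 0)); rewrite -cmpDr !add0r. Qed.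

Lemma cmpNm (U V W : C) (g : Mor V W) (f : Mor U V) : (- g) ∘ f = - (g ∘ f).
Proof. by apply: (addIr (g ∘ f)); rewrite -cmpDl !addNr cmp0m. Qed.

Definition mono (X Y : C) (f : Mor X Y) : Prop :=
  forall (W : C) (g h : Mor W X), f ∘ g = f ∘ h -> g = h.

Definition epi (X Y : C) (f : Mor X Y) : Prop :=
  forall (W : C) (g h : Mor Y W), g ∘ f = h ∘ f -> g = h.

Definition is_kernel (K X Y : C) (k : Mor K X) (f : Mor X Y) : Prop :=
  f ∘ k = 0 /\
  forall (W : C) (g : Mor W X), f ∘ g = 0 -> exists! h : Mor W K, k ∘ h = g.

Definition is_cokernel (X Y Q : C) (q : Mor Y Q) (f : Mor X Y) : Prop :=
  q ∘ f = 0 /\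
  forall (W : C) (g : Mor Y W), g ∘ f = 0 -> exists! h : Mor Q W, h ∘ q = g.

Definition is_zero_object (O : C) : Prop :=
  forall X : C,
    (forall f : Mor O X, f = 0) /\ (forall f : Mor X O, f = 0).

Definition is_biproduct (X Y P : C) (iX : Mor X P) (iY : Mor Y P)
    (pX : Mor P X) (pY : Mor P Y) : Prop :=
  [/\ pX ∘ iX = idm X, pY ∘ iY = idm Y, pX ∘ iY = 0, pY ∘ iX = 0
    & iX ∘ pX + iY ∘ pY = idm P].

Record is_abelian : Prop := IsAbelian {
  has_zero_object : exists O : C, is_zero_object O;
  has_biproducts : forall X Y : C,
    exists (P : C) (iX : Mor X P) (iY : Mor Y P)
      (pX : Mor P X) (pY : Mor P Y), is_biproduct iX iY pX pY;
  has_kernels : forall (X Y : C) (f : Mor X Y),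
    exists (K : C) (k : Mor K X), is_kernel k f;
  has_cokernels : forall (X Y : C) (f : Mor X Y),
    exists (Q : C) (q : Mor Y Q), is_cokernel q f;
  mono_normal : forall (X Y : C) (f : Mor X Y), mono f ->
    exists (Z : C) (g : Mor Y Z), is_kernel f g;
  epi_normal : forall (X Y : C) (f : Mor X Y), epi f ->
    exists (W : C) (g : Mor W X), is_cokernel f g
}.

Definition short_exact (X Y Z : C) (f : Mor X Y) (g : Mor Y Z) : Prop :=
  is_kernel f g /\ is_cokernel g f.

End Abelian.

Record functor (C D : preadditive) := Functor {
  fobj :> C -> D;
  fmap : forall X Y : C, Mor X Y -> Mor (fobj X) (fobj Y);
  fmap1 : forall X : C, fmap (idm X) = idm (fobj X);
  fmapM : forall (X Y Z : C) (g : Mor Y Z) (f : Mor X Y),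
    fmap (g ∘ f) = fmap g ∘ fmap f
}.

Arguments fmap {C D} F {X Y} f : rename.

Definition additive_functor (C D : preadditive) (F : functor C D) : Prop :=
  forall (X Y : C) (f g : Mor X Y), fmap F (f + g) = fmap F f + fmap F g.

(* [X -> Y -> Z -> 0] is exact iff [g] is a cokernel of [f]. *)
Definition right_exact_functor (C D : preadditive) (F : functor C D) : Prop :=
  additive_functor F /\
  forall (X Y Z : C) (f : Mor X Y) (g : Mor Y Z),
    is_cokernel g f -> is_cokernel (fmap F g) (fmap F f).

Definition exact_functor (C D : preadditive) (F : functor C D) : Prop :=
  additive_functor F /\
  forall (X Y Z : C) (f : Mor X Y) (g : Mor Y Z),
    short_exact f g -> short_exact (fmap F f) (fmap F g).

(* Functors to the category of abelian groups, whose objects are [zmodType]s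
   and whose short exact sequences are described elementwise. *)
Record ab_functor (C : preadditive) := AbFunctor {
  abobj :> C -> zmodType;
  abmap : forall X Y : C, Mor X Y -> {additive abobj X -> abobj Y};
  abmap1 : forall (X : C) (x : abobj X), abmap (idm X) x = x;
  abmapM : forall (X Y Z : C) (g : Mor Y Z) (f : Mor X Y) (x : abobj X),
    abmap (g ∘ f) x = abmap g (abmap f x)
}.

Arguments abmap {C} F {X Y} f : rename.

Definition ab_short_exact (A B C : zmodType)
    (f : {additive A -> B}) (g : {additive B -> C}) : Prop :=
  [/\ injective f,
      forall y : B, g y = 0 <-> exists x : A, f x = y
    & forall z : C, exists y : B, g y = z].

Definition ab_exact (C : preadditive) (F : ab_functor C) : Prop :=
  (forall (X Y : C) (f g : Mor X Y) (x : F X),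
     abmap F (f + g) x = abmap F f x + abmap F g x) /\
  forall (X Y Z : C) (f : Mor X Y) (g : Mor Y Z),
    short_exact f g -> ab_short_exact (abmap F f) (abmap F g).

Definition jointly_faithful (C : preadditive) (S : Type)
    (F : S -> ab_functor C) : Prop :=
  forall (X Y : C) (f g : Mor X Y),
    (forall (a : S) (x : F a X), abmap (F a) f x = abmap (F a) g x) -> f = g.

Definition codirected (d : Order.disp_t) (I : porderType d) : Prop :=
  inhabited I /\ forall i j : I, exists k : I, (k <= i)%O /\ (k <= j)%O.

(* A functor [idx -> C]; going down in [idx] gives the transition maps
   [Hom(P_i, X) -> Hom(P_k, X)], [k <= i], of a directed system. *)
Record inverse_system (C : preadditive) := InverseSystem {
  idisp : Order.disp_t;
  idx : porderType idisp;
  idx_codirected : codirected idx;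
  sysobj :> idx -> C;
  sysmap : forall i j : idx, (i <= j)%O -> Mor (sysobj i) (sysobj j);
  sysmap1 : forall (i : idx) (ii : (i <= i)%O), sysmap ii = idm (sysobj i);
  sysmapM : forall (i j k : idx) (ij : (i <= j)%O) (jk : (j <= k)%O)
    (ik : (i <= k)%O), sysmap jk ∘ sysmap ij = sysmap ik
}.

Section Colim.
Variables (C : preadditive) (P : inverse_system C) (X : C).

(* [f : P_i -> X] and [g : P_j -> X] represent the same element of the
   filtered colimit iff they agree on some [P_k] with [k <= i, j]. *)
Definition germ : Type := {i : idx P & Mor (P i) X}.
HB.instance Definition _ := Choice.on germ.

Definition same_germ (s t : germ) : bool :=
  `[< exists (k : idx P) (ks : (k <= tag s)%O) (kt : (k <= tag t)%O),
        tagged s ∘ sysmap ks = tagged t ∘ sysmap kt >].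

Lemma same_germ_equiv : equiv_class_of same_germ.
Proof.
split.
- by move=> s; apply/asboolP; exists (tag s), (Order.le_refl _), (Order.le_refl _).
- move=> s t; apply/asboolP/asboolP => -[k [k1 [k2 e]]];
  by exists k, k2, k1.
- move=> t s u /asboolP[k [ks [kt e1]]] /asboolP[l [lt [lu e2]]].
  have [m [mk ml]] := (idx_codirected P).2 k l.
  apply/asboolP; exists m, (Order.le_trans mk ks), (Order.le_trans ml lu).
  rewrite -(sysmapM mk ks) -(sysmapM ml lu) !cmpA e1 -e2 -!cmpA.
  by congr (_ ∘ _); rewrite !(sysmapM _ _ (Order.le_trans mk kt)).
Qed.

Canonical same_germ_rel := EquivRelPack same_germ_equiv.

Definition colim_hom : Type := {eq_quot same_germ_rel}.
HB.instance Definition _ := Choice.on colim_hom.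

(* The structure map [Hom(P_i, X) -> colim_i Hom(P_i, X)]. *)
Definition colim_inj (i : idx P) (f : Mor (P i) X) : colim_hom :=
  \pi_({eq_quot same_germ_rel}) (Tagged (fun i => Mor (P i) X) f).

Lemma colim_injP (i j : idx P) (f : Mor (P i) X) (g : Mor (P j) X) :
  colim_inj f = colim_inj g <->
  exists (k : idx P) (ki : (k <= i)%O) (kj : (k <= j)%O),
    f ∘ sysmap ki = g ∘ sysmap kj.
Proof.
rewrite /colim_inj; split.
  by move/eqP; rewrite (eqmodE same_germ_rel) => /asboolP.
by move=> e; apply/eqP; rewrite (eqmodE same_germ_rel); apply/asboolP.
Qed.

Lemma colim_inj_trans (i k : idx P) (ki : (k <= i)%O) (f : Mor (P i) X) :
  colim_inj f = colim_inj (f ∘ sysmap ki).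
Proof.
apply/colim_injP; exists k, ki, (Order.le_refl k).
by rewrite sysmap1 cmpm1.
Qed.

Lemma colim_surj (x : colim_hom) :
  exists (i : idx P) (f : Mor (P i) X), x = colim_inj f.
Proof.
by exists (tag (repr x)), (tagged (repr x)); rewrite /colim_inj taggedK reprK.
Qed.

Definition idx0 : idx P :=
  projT1 (cid (let: inhabits i := (idx_codirected P).1 in ex_intro xpredT i isT)).

Definition lower (i j : idx P) : idx P :=
  projT1 (cid ((idx_codirected P).2 i j)).

Lemma lower_l (i j : idx P) : (lower i j <= i)%O.
Proof. by rewrite /lower; case: cid => k []. Qed.

Lemma lower_r (i j : idx P) : (lower i j <= j)%O.
Proof. by rewrite /lower; case: cid => k []. Qed.

Definition colim_zero : colim_hom := colim_inj (0 : Mor (P idx0) X).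

Definition colim_opp (x : colim_hom) : colim_hom :=
  colim_inj (- tagged (repr x)).

Definition colim_add (x y : colim_hom) : colim_hom :=
  let s := repr x in let t := repr y in
  colim_inj (tagged s ∘ sysmap (lower_l (tag s) (tag t)) +
             tagged t ∘ sysmap (lower_r (tag s) (tag t))).

Lemma colim_zeroE (i : idx P) : colim_zero = colim_inj (0 : Mor (P i) X).
Proof.
have [k [k0 ki]] := (idx_codirected P).2 idx0 i.
by apply/colim_injP; exists k, k0, ki; rewrite !cmp0m.
Qed.

Lemma repr_colim (i : idx P) (f : Mor (P i) X) :
  exists (k : idx P) (kr : (k <= tag (repr (colim_inj f)))%O) (ki : (k <= i)%O),
    tagged (repr (colim_inj f)) ∘ sysmap kr = f ∘ sysmap ki.
Proof. by apply/colim_injP; rewrite {1}/colim_inj taggedK reprK. Qed.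

Lemma colim_oppE (i : idx P) (f : Mor (P i) X) :
  colim_opp (colim_inj f) = colim_inj (- f).
Proof.
have [k [kr [ki e]]] := repr_colim f.
by apply/colim_injP; exists k, kr, ki; rewrite !cmpNm e.
Qed.

Lemma colim_addE (i : idx P) (f g : Mor (P i) X) :
  colim_add (colim_inj f) (colim_inj g) = colim_inj (f + g).
Proof.
have [k [kr [ki e]]] := repr_colim f.
have [l [lr [li e']]] := repr_colim g.
rewrite /colim_add; set s := repr _ in kr e *; set t := repr _ in lr e' *.
have [m1 [m1k m1l]] := (idx_codirected P).2 k l.
have [m [mm mlow]] := (idx_codirected P).2 m1 (lower (tag s) (tag t)).
have mk := Order.le_trans mm m1k; have ml := Order.le_trans mm m1l.
have mi := Order.le_trans mk ki.
apply/colim_injP; exists m, mlow, mi; rewrite !cmpDl; congr (_ + _).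
- rewrite -cmpA (sysmapM _ _ (Order.le_trans mk kr)) -(sysmapM mk kr) cmpA e.
  by rewrite -cmpA (sysmapM mk ki mi).
- rewrite -cmpA (sysmapM _ _ (Order.le_trans ml lr)) -(sysmapM ml lr) cmpA e'.
  by rewrite -cmpA (sysmapM ml li mi).
Qed.

Lemma colim_surj2 (x y : colim_hom) :
  exists (i : idx P) (f g : Mor (P i) X), x = colim_inj f /\ y = colim_inj g.
Proof.
have [i [f ->]] := colim_surj x; have [j [g ->]] := colim_surj y.
have [k [ki kj]] := (idx_codirected P).2 i j.
by exists k, (f ∘ sysmap ki), (g ∘ sysmap kj); rewrite -!colim_inj_trans.
Qed.

Lemma colim_addA : associative colim_add.
Proof.
move=> x y z; have [i [f [g [-> ->]]]] := colim_surj2 x y.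
have [j [h ->]] := colim_surj z.
have [k [ki kj]] := (idx_codirected P).2 i j.
rewrite (colim_inj_trans ki f) (colim_inj_trans ki g) (colim_inj_trans kj h).
by rewrite !colim_addE addrA.
Qed.

Lemma colim_addC : commutative colim_add.
Proof.
move=> x y; have [i [f [g [-> ->]]]] := colim_surj2 x y.
by rewrite !colim_addE addrC.
Qed.

Lemma colim_add0 : left_id colim_zero colim_add.
Proof.
move=> x; have [i [f ->]] := colim_surj x.
by rewrite (colim_zeroE i) colim_addE add0r.
Qed.

Lemma colim_addN : left_inverse colim_zero colim_opp colim_add.
Proof.
move=> x; have [i [f ->]] := colim_surj x.
by rewrite colim_oppE colim_addE addNr (colim_zeroE i).
Qed.

HB.instance Definition _ := GRing.isZmodule.Build colim_hom
  colim_addA colim_addC colim_add0 colim_addN.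

Lemma colim_injD (i : idx P) (f g : Mor (P i) X) :
  colim_inj (f + g) = colim_inj f + colim_inj g.
Proof. by rewrite -colim_addE. Qed.

End Colim.

Section ColimFunctor.
Variables (C : preadditive) (P : inverse_system C).

Definition colim_map (X Y : C) (h : Mor X Y) (x : colim_hom P X) :
  colim_hom P Y := colim_inj (h ∘ tagged (repr x)).

Lemma colim_mapE (X Y : C) (h : Mor X Y) (i : idx P) (f : Mor (P i) X) :
  colim_map h (colim_inj f) = colim_inj (h ∘ f).
Proof.
have [k [kr [ki e]]] := repr_colim f.
by apply/colim_injP; exists k, kr, ki; rewrite -!cmpA e.
Qed.

Lemma colim_map_zmod (X Y : C) (h : Mor X Y) : nmod_morphism (colim_map h).
Proof.
split=> [|x y].
  by have -> : 0 = colim_zero P X by []; rewrite colim_mapE cmpm0 -colim_zeroE.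
have [i [f [g [-> ->]]]] := colim_surj2 x y.
by rewrite -colim_injD !colim_mapE cmpDr colim_injD.
Qed.

HB.instance Definition _ (X Y : C) (h : Mor X Y) :=
  GRing.isNmodMorphism.Build (colim_hom P X) (colim_hom P Y) (colim_map h)
    (colim_map_zmod h).

Lemma colim_map1 (X : C) (x : colim_hom P X) : colim_map (idm X) x = x.
Proof. by have [i [f ->]] := colim_surj x; rewrite colim_mapE cmp1m. Qed.

Lemma colim_mapM (X Y Z : C) (g : Mor Y Z) (f : Mor X Y) (x : colim_hom P X) :
  colim_map (g ∘ f) x = colim_map g (colim_map f x).
Proof. by have [i [u ->]] := colim_surj x; rewrite !colim_mapE cmpA. Qed.

(* [colim_i Hom(P_i, -)] *)
Definition colim_functor : ab_functor C :=
  @AbFunctor C (fun X => colim_hom P X : zmodType)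
    (fun X Y h => colim_map h : {additive colim_hom P X -> colim_hom P Y})
    colim_map1 colim_mapM.

End ColimFunctor.

Record monoidal := Monoidal {
  mcat :> preadditive;
  tens : mcat -> mcat -> mcat;
  tensm : forall X X' Y Y' : mcat, Mor X X' -> Mor Y Y' ->
    Mor (tens X Y) (tens X' Y');
  tensm1 : forall X Y : mcat, tensm (idm X) (idm Y) = idm (tens X Y);
  tensmM : forall (X X' X'' Y Y' Y'' : mcat)
    (f' : Mor X' X'') (f : Mor X X') (g' : Mor Y' Y'') (g : Mor Y Y'),
    tensm (f' ∘ f) (g' ∘ g) = tensm f' g' ∘ tensm f g;
  unitob : mcat;
  assoc : forall X Y Z : mcat, Mor (tens (tens X Y) Z) (tens X (tens Y Z));
  associ : forall X Y Z : mcat, Mor (tens X (tens Y Z)) (tens (tens X Y) Z);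
  lunit : forall X : mcat, Mor (tens unitob X) X;
  luniti : forall X : mcat, Mor X (tens unitob X);
  runit : forall X : mcat, Mor (tens X unitob) X;
  runiti : forall X : mcat, Mor X (tens X unitob);
  assocK : forall X Y Z : mcat, associ X Y Z ∘ assoc X Y Z = idm _;
  associK : forall X Y Z : mcat, assoc X Y Z ∘ associ X Y Z = idm _;
  lunitK : forall X : mcat, luniti X ∘ lunit X = idm _;
  lunitiK : forall X : mcat, lunit X ∘ luniti X = idm _;
  runitK : forall X : mcat, runiti X ∘ runit X = idm _;
  runitiK : forall X : mcat, runit X ∘ runiti X = idm _;
  assoc_nat : forall (X X' Y Y' Z Z' : mcat)
    (f : Mor X X') (g : Mor Y Y') (h : Mor Z Z'),
    assoc X' Y' Z' ∘ tensm (tensm f g) h =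
    tensm f (tensm g h) ∘ assoc X Y Z;
  lunit_nat : forall (X X' : mcat) (f : Mor X X'),
    lunit X' ∘ tensm (idm unitob) f = f ∘ lunit X;
  runit_nat : forall (X X' : mcat) (f : Mor X X'),
    runit X' ∘ tensm f (idm unitob) = f ∘ runit X;
  pentagon : forall X Y Z W : mcat,
    assoc X Y (tens Z W) ∘ assoc (tens X Y) Z W =
    tensm (idm X) (assoc Y Z W) ∘ assoc X (tens Y Z) W
      ∘ tensm (assoc X Y Z) (idm W);
  triangle : forall X Y : mcat,
    tensm (idm X) (lunit Y) ∘ assoc X unitob Y = tensm (runit X) (idm Y)
}.

Arguments tens {m} X Y.
Arguments tensm {m X X' Y Y'} f g.
Arguments unitob {m}.
Arguments assoc {m} X Y Z.
Arguments associ {m} X Y Z.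
Arguments lunit {m} X.
Arguments luniti {m} X.
Arguments runit {m} X.
Arguments runiti {m} X.

Notation "X ⊗ Y" := (tens X Y) (at level 40, left associativity) : cat_scope.
Notation "f ⊗m g" := (tensm f g) (at level 40, left associativity) : cat_scope.

Section Monoidal.
Variable B : monoidal.

Definition ltens (X : B) : functor B B.
Proof.
apply: (@Functor B B (fun W => X ⊗ W) (fun W W' f => idm X ⊗m f)).
- by move=> W; apply: tensm1.
- by move=> W W' W'' g f; rewrite -tensmM cmp1m.
Defined.

Definition rtens (X : B) : functor B B.
Proof.
apply: (@Functor B B (fun W => W ⊗ X) (fun W W' f => f ⊗m idm X)).
- by move=> W; apply: tensm1.
- by move=> W W' W'' g f; rewrite -tensmM cmp1m.
Defined.

Definition right_exact_tensor : Prop :=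
  forall X : B, right_exact_functor (ltens X) /\ right_exact_functor (rtens X).

Definition left_flat (X : B) : Prop := exact_functor (rtens X).

(* [H] represents the presheaf [W |-> Hom(X ⊗ W, Z)]; a natural bijection is
   automatically additive, since [X ⊗ -] is. *)
Definition represents_hom_tensor (X Z H : B) : Prop :=
  exists phi : forall W : B, Mor W H -> Mor (X ⊗ W) Z,
    (forall W : B, bijective (phi W)) /\
    (forall (W W' : B) (u : Mor W' W) (g : Mor W H),
       phi W' (g ∘ u) = phi W g ∘ fmap (ltens X) u).

(* The zig-zags [X -> X D X -> X] and [D -> D X D -> D]. *)
Definition is_right_dual (X D : B)
    (ev : Mor (X ⊗ D) unitob) (coev : Mor unitob (D ⊗ X)) : Prop :=
  lunit X ∘ (ev ⊗m idm X) ∘ associ X D X ∘ (idm X ⊗m coev) ∘ runiti X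
    = idm X /\
  runit D ∘ (idm D ⊗m ev) ∘ assoc D X D ∘ (coev ⊗m idm D) ∘ luniti D
    = idm D.

Definition right_rigid (X : B) : Prop :=
  exists (D : B) (ev : Mor (X ⊗ D) unitob) (coev : Mor unitob (D ⊗ X)),
    is_right_dual ev coev.

End Monoidal.

(* Main.v *)
Require Import Defs.
From mathcomp Require Import all_boot all_order all_algebra.

Set Implicit Arguments.
Unset Strict Implicit.
Unset Printing Implicit Defensive.

Import GRing.Theory.
Local Open Scope ring_scope.
Local Open Scope cat_scope.

(** Write [[X, W]] for the internal hom, the object representing
    [Hom(X ⊗ -, W)]. If [X] has a right dual [D], then [D ⊗ -] is right adjoint
    to [X ⊗ -], so [[X, W]] is [D ⊗ W] (dual_tens_ihom). Conversely [Y] is rigid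
    as soon as the comparison morphism [[Y, 1] ⊗ Y -> [Y, Y]] has a section:
    the section turns the name of the identity of [Y] into a coevaluation, which
    satisfies one zig-zag by construction and the other by the universal property
    of [[Y, 1]] (ihom_dual).

    To compare, apply [[-, W]] to the extension [X -> Y -> Z]. The result
    [0 -> [Z, W] -> [Y, W] -> [X, W] -> 0] is exact (ihom_exact). Left exactness
    is formal, since [- ⊗ T] preserves cokernels. For surjectivity on the right,
    take one of the inverse systems [P]: a morphism [X ⊗ P_i -> W], restricted
    to [X ⊗ P_k] for some [k <= i], extends to [Y ⊗ P_k -> W]. Indeed, as
    [P_i] is left flat, [X ⊗ P_i -> Y ⊗ P_i -> Z ⊗ P_i] is short exact, and
    the rigidity of [Z] turns a splitting of it over [Z ⊗ P_k] into a lifting problem for the unit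
    [P_i -> D ⊗ (Z ⊗ P_i)], which the exactness of [colim_i Hom(P_i, -)] solves
    (pro_retraction). Joint faithfulness then makes [[Y, W] -> [X, W]] epi.

    Tensoring the exact sequence for [W = 1] with [Y] gives a right exact row
    over the exact row for [W = Y]. The comparison morphisms at the two ends are
    isomorphisms because [X] and [Z] are rigid, so the middle one is by the short
    five lemma (short_five). *)

(** * Kernels, cokernels and the short five lemma *)

Section AbelianLemmas.
Variable C : preadditive.

Lemma cmpmB (U V W : C) (g : Mor V W) (a b : Mor U V) :
  g ∘ (a - b) = g ∘ a - g ∘ b.
Proof. by apply: (addIr (g ∘ b)); rewrite -cmpDr !subrK. Qed.

Lemma cmpBm (U V W : C) (a b : Mor V W) (f : Mor U V) :
  (a - b) ∘ f = a ∘ f - b ∘ f.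
Proof. by rewrite cmpDl cmpNm. Qed.

Lemma mono0P (X Y : C) (f : Mor X Y) :
  (forall (W : C) (h : Mor W X), f ∘ h = 0 -> h = 0) -> mono f.
Proof.
move=> f0 W g h e; apply/eqP; rewrite -subr_eq0; apply/eqP/f0.
by rewrite cmpmB e subrr.
Qed.

Lemma epi0P (X Y : C) (f : Mor X Y) :
  (forall (W : C) (h : Mor Y W), h ∘ f = 0 -> h = 0) -> epi f.
Proof.
move=> f0 W g h e; apply/eqP; rewrite -subr_eq0; apply/eqP/f0.
by rewrite cmpBm e subrr.
Qed.

Lemma kernel_mono (K X Y : C) (k : Mor K X) (f : Mor X Y) :
  is_kernel k f -> mono k.
Proof.
move=> [fk0 univ] W g h e.
have [|l [_ l_uniq]] := univ W (k ∘ h); first by rewrite cmpA fk0 cmp0m.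
by rewrite -(l_uniq _ e) (l_uniq h).
Qed.

Lemma cokernel_epi (X Y Q : C) (q : Mor Y Q) (f : Mor X Y) :
  is_cokernel q f -> epi q.
Proof.
move=> [qf0 univ] W g h e.
have [|l [_ l_uniq]] := univ W (h ∘ q); first by rewrite -cmpA qf0 cmpm0.
by rewrite -(l_uniq _ e) (l_uniq h).
Qed.

Lemma mono_kernel_of_cokernel (abC : is_abelian C) (X Y Q : C)
    (k : Mor X Y) (q : Mor Y Q) :
  mono k -> is_cokernel q k -> is_kernel k q.
Proof.
move=> km [qk0 univ]; split=> // W w qw0.
have [Z [h [hk0 h_univ]]] := mono_normal abC km.
have [h' [eh _]] := univ _ h hk0.
by apply: h_univ; rewrite -eh -cmpA qw0 cmpm0.
Qed.

Lemma epi_cokernel_of_kernel (abC : is_abelian C) (X Y K : C)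
    (q : Mor X Y) (k : Mor K X) :
  epi q -> is_kernel k q -> is_cokernel q k.
Proof.
move=> qe [qk0 univ]; split=> // W w wk0.
have [Z [h [qh0 h_univ]]] := epi_normal abC qe.
have [h' [eh _]] := univ _ h qh0.
by apply: h_univ; rewrite -eh cmpA wk0 cmp0m.
Qed.

Lemma mono_epi_section (abC : is_abelian C) (X Y : C) (f : Mor X Y) :
  mono f -> epi f -> exists s : Mor Y X, f ∘ s = idm Y.
Proof.
move=> fm fe; have [Z [h [hf0 univ]]] := mono_normal abC fm.
have h0 : h = 0 by apply: fe; rewrite hf0 cmp0m.
by have [|s [es _]] := univ Y (idm Y); [rewrite h0 cmp0m | exists s].
Qed.

(** The short five lemma for a morphism of extensions that is the identity on
    both ends; exactness of the upper row at [A] comes for free from the lower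
    one, because [t ∘ i] is a monomorphism. *)
Lemma short_five (abC : is_abelian C) (A E E' Q : C)
    (i : Mor A E) (p : Mor E Q) (i' : Mor A E') (p' : Mor E' Q) (t : Mor E E') :
  is_cokernel p i -> short_exact i' p' -> t ∘ i = i' -> p' ∘ t = p ->
  exists s : Mor E' E, t ∘ s = idm E'.
Proof.
move=> cok_pi [ker_i' cok_p'] ti pt.
have i'_mono := kernel_mono ker_i'.
have i_mono : mono i.
  by move=> W u v e; apply: i'_mono; rewrite -ti -!cmpA e.
have [_ i_univ] := mono_kernel_of_cokernel abC i_mono cok_pi.
apply: mono_epi_section => //.
- apply: mono0P => W u tu0.
  have [|v [ev _]] := i_univ _ u; first by rewrite -pt -cmpA tu0 cmpm0.
  have v0 : v = 0 by apply: i'_mono; rewrite cmpm0 -ti -cmpA ev.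
  by rewrite -ev v0 cmpm0.
- apply: epi0P => W u ut0.
  have [|v [ev _]] := cok_p'.2 _ u; first by rewrite -ti cmpA ut0 cmp0m.
  have v0 : v = 0.
    by apply: (cokernel_epi cok_pi); rewrite cmp0m -pt cmpA ev.
  by rewrite -ev v0 cmp0m.
Qed.

End AbelianLemmas.

(** * Exact filtered colimits of Hom functors *)

Section ProSystems.
Variable C : preadditive.

(** Exactness of [colim_i Hom(P_i, -)] says that the pro-object [P] is
    projective: a morphism lifts along an epimorphism after passing to a lower
    index. *)
Lemma pro_lift (abC : is_abelian C) (P : inverse_system C)
    (exP : ab_exact (colim_functor P)) (A Q : C) (q : Mor A Q) (i : idx P)
    (t : Mor (P i) Q) :
  epi q ->
  exists (k : idx P) (ki : (k <= i)%O) (s : Mor (P k) A),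
    q ∘ s = t ∘ sysmap ki.
Proof.
move=> q_epi; have [K [k ker_k]] := has_kernels abC q.
have [_ _ q_surj] := exP.2 _ _ _ k q
  (conj ker_k (epi_cokernel_of_kernel abC q_epi ker_k)).
have [y] := q_surj (colim_inj t); have [j [s ->]] := colim_surj y.
rewrite /= colim_mapE => /colim_injP[l [lj [li e]]].
by exists l, li, (s ∘ sysmap lj); rewrite cmpA.
Qed.

(** The converse for the whole family: such liftings make every
    [colim_i Hom(P_i, q)] surjective, and a jointly faithful
    family reflects epimorphisms. *)
Lemma pro_lift_epi (S : Type) (P : S -> inverse_system C)
    (faithful : jointly_faithful (fun a : S => colim_functor (P a)))
    (A Q : C) (q : Mor A Q) :
  (forall (a : S) (i : idx (P a)) (t : Mor (P a i) Q),
     exists (k : idx (P a)) (ki : (k <= i)%O) (s : Mor (P a k) A),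
       q ∘ s = t ∘ sysmap ki) ->
  epi q.
Proof.
move=> lift W u v e; apply: faithful => a x /=.
have [i [t ->]] := colim_surj x; have [k [ki [s es]]] := lift a i t.
by rewrite (colim_inj_trans ki) -es !colim_mapE !cmpA e.
Qed.

End ProSystems.

(** * Coherence of the unit constraints *)

Section MonoidalLemmas.
Variable B : monoidal.

Lemma ltensmM (X U V W : B) (g : Mor V W) (f : Mor U V) :
  idm X ⊗m (g ∘ f) = (idm X ⊗m g) ∘ (idm X ⊗m f).
Proof. by rewrite -tensmM cmp1m. Qed.

Lemma rtensmM (X U V W : B) (g : Mor V W) (f : Mor U V) :
  (g ∘ f) ⊗m idm X = (g ⊗m idm X) ∘ (f ⊗m idm X).
Proof. by rewrite -tensmM cmp1m. Qed.

Lemma tensm_lr (X X' Y Y' : B) (f : Mor X X') (g : Mor Y Y') :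
  (f ⊗m idm Y') ∘ (idm X ⊗m g) = (idm X' ⊗m g) ∘ (f ⊗m idm Y).
Proof. by rewrite -!tensmM !cmp1m !cmpm1. Qed.

Lemma associ_nat (X X' Y Y' Z Z' : B)
    (f : Mor X X') (g : Mor Y Y') (h : Mor Z Z') :
  associ X' Y' Z' ∘ (f ⊗m (g ⊗m h)) = ((f ⊗m g) ⊗m h) ∘ associ X Y Z.
Proof.
rewrite -[LHS]cmpm1 -(associK X Y Z) cmpA -(cmpA _ _ (assoc X Y Z)).
by rewrite -assoc_nat cmpA assocK cmp1m.
Qed.

Lemma luniti_nat (X X' : B) (f : Mor X X') :
  (idm unitob ⊗m f) ∘ luniti X = luniti X' ∘ f.
Proof.
rewrite -[LHS]cmp1m -(lunitK X') -cmpA (cmpA (lunit X')) lunit_nat.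
by rewrite -(cmpA f) lunitiK cmpm1.
Qed.

Lemma assoc_epi (X Y Z : B) : epi (assoc X Y Z).
Proof.
by move=> W g h e; rewrite -[g]cmpm1 -[h]cmpm1 -(associK X Y Z) !cmpA e.
Qed.

Lemma assoc_mono (X Y Z : B) : mono (assoc X Y Z).
Proof.
by move=> W g h e; rewrite -[g]cmp1m -[h]cmp1m -(assocK X Y Z) -!cmpA e.
Qed.

Lemma lunit_mono (X : B) : mono (lunit X).
Proof. by move=> W g h e; rewrite -[g]cmp1m -[h]cmp1m -(lunitK X) -!cmpA e. Qed.

Lemma ltens_unit_inj (X Y : B) (f g : Mor X Y) :
  idm unitob ⊗m f = idm unitob ⊗m g -> f = g.
Proof.
move=> e; rewrite -[f]cmpm1 -[g]cmpm1 -(lunitiK X) !cmpA.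
by rewrite -!lunit_nat e.
Qed.

Lemma rtens_unit_inj (X Y : B) (f g : Mor X Y) :
  f ⊗m idm unitob = g ⊗m idm unitob -> f = g.
Proof.
move=> e; rewrite -[f]cmpm1 -[g]cmpm1 -(runitiK X) !cmpA.
by rewrite -!runit_nat e.
Qed.

Lemma rtens_assoc_epi (X Y Z W : B) : epi (assoc X Y Z ⊗m idm W).
Proof.
move=> T g h e; rewrite -[g]cmpm1 -[h]cmpm1 -tensm1 -(associK X Y Z).
by rewrite rtensmM !cmpA e.
Qed.

(** Kelly's consequence of the pentagon and the triangle: tensoring with
    [unitob] on the left, both sides become equal by the pentagon for
    [unitob, unitob, X, Y]. *)
Lemma lunit_tens (X Y : B) :
  lunit (X ⊗ Y) ∘ assoc unitob X Y = lunit X ⊗m idm Y.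
Proof.
apply/ltens_unit_inj/(@assoc_epi _ _ _)/(@rtens_assoc_epi _ _ _ _).
rewrite ltensmM -!cmpA (cmpA (idm _ ⊗m assoc _ _ _)) -pentagon cmpA triangle.
rewrite -[idm (X ⊗ Y)]tensm1 -assoc_nat -triangle rtensmM cmpA assoc_nat.
by rewrite -cmpA.
Qed.

(** Likewise, with the pentagon for [X, Y, unitob, unitob]. *)
Lemma runit_tens (X Y : B) :
  (idm X ⊗m runit Y) ∘ assoc X Y unitob = runit (X ⊗ Y).
Proof.
apply/rtens_unit_inj/(@assoc_mono _ _ _).
rewrite rtensmM cmpA assoc_nat -triangle ltensmM.
rewrite -triangle -[idm (X ⊗ Y)]tensm1 [RHS]cmpA assoc_nat -[RHS]cmpA.
by rewrite pentagon !cmpA.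
Qed.

Lemma lunit_unitob : lunit (unitob : B) = runit unitob.
Proof.
apply: rtens_unit_inj; rewrite -triangle -lunit_tens; congr (_ ∘ _).
by apply: lunit_mono; rewrite lunit_nat.
Qed.

(** * Internal homs and duals *)

(** [e] exhibits [H] as the internal hom from [X] to [Z]. *)
Definition is_ihom (X Z H : B) (e : Mor (X ⊗ H) Z) : Prop :=
  forall (T : B) (u : Mor (X ⊗ T) Z),
    exists! v : Mor T H, e ∘ (idm X ⊗m v) = u.

Lemma ihom_inj (X Z H : B) (e : Mor (X ⊗ H) Z) (T : B) (v w : Mor T H) :
  is_ihom e -> e ∘ (idm X ⊗m v) = e ∘ (idm X ⊗m w) -> v = w.
Proof.
move=> univ evw; have [z [_ z_uniq]] := univ _ (e ∘ (idm X ⊗m w)).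
by rewrite -(z_uniq _ evw) (z_uniq w).
Qed.

(** By Yoneda, a representation is determined by the image of the identity of
    [H]. *)
Lemma represents_ihom (X Z H : B) :
  represents_hom_tensor X Z H -> exists e : Mor (X ⊗ H) Z, is_ihom e.
Proof.
move=> [phi [bij nat]]; exists (phi H (idm H)) => T u.
have phiE v : phi T v = phi H (idm H) ∘ (idm X ⊗m v) by rewrite -nat cmp1m.
have [psi phiK psiK] := bij T.
by exists (psi u); split=> [|v]; rewrite -phiE ?psiK // => <-; rewrite phiK.
Qed.

(** The canonical pairing of [X] with [D ⊗ W] induced by one of [X] with [D]. *)
Definition tens_pairing (X D : B) (e : Mor (X ⊗ D) unitob) (W : B) :
    Mor (X ⊗ (D ⊗ W)) W :=
  lunit W ∘ (e ⊗m idm W) ∘ associ X D W.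

Lemma tens_pairing_cmpr (X D D' : B) (e : Mor (X ⊗ D) unitob) (h : Mor D' D)
    (W : B) :
  tens_pairing (e ∘ (idm X ⊗m h)) W
    = tens_pairing e W ∘ (idm X ⊗m (h ⊗m idm W)).
Proof. by rewrite /tens_pairing rtensmM -!cmpA associ_nat. Qed.

Lemma tens_pairing_cmpl (X X' D : B) (e : Mor (X ⊗ D) unitob) (h : Mor X' X)
    (W : B) :
  tens_pairing (e ∘ (h ⊗m idm D)) W = tens_pairing e W ∘ (h ⊗m idm (D ⊗ W)).
Proof. by rewrite /tens_pairing rtensmM -tensm1 -!cmpA associ_nat. Qed.

Lemma tens_pairing_natural (X D : B) (e : Mor (X ⊗ D) unitob) (W W' : B)
    (u : Mor W W') :
  tens_pairing e W' ∘ (idm X ⊗m (idm D ⊗m u)) = u ∘ tens_pairing e W.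
Proof.
rewrite /tens_pairing -!cmpA associ_nat tensm1.
rewrite (cmpA (e ⊗m _)) tensm_lr !cmpA.
by rewrite lunit_nat.
Qed.

Lemma tens_pairing_unit (X D : B) (e : Mor (X ⊗ D) unitob) :
  tens_pairing e unitob = e ∘ (idm X ⊗m runit D).
Proof.
rewrite /tens_pairing lunit_unitob runit_nat -runit_tens.
by rewrite -!cmpA associK cmpm1.
Qed.

(** Pairing commutes with tensoring on the right: both sides come from the
    pairing by the two paths of the pentagon for [X, D, W, T]. *)
Lemma tens_pairing_tens (X D : B) (e : Mor (X ⊗ D) unitob) (W T : B) :
  tens_pairing e (W ⊗ T) ∘ (idm X ⊗m assoc D W T)
    = (tens_pairing e W ⊗m idm T) ∘ associ X (D ⊗ W) T.
Proof.
apply/(@assoc_epi _ _ _)/(@rtens_assoc_epi _ _ _ _).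
rewrite -(cmpA (_ ⊗m idm T)) assocK cmpm1 -rtensmM.
rewrite /tens_pairing -!cmpA (cmpA (idm _ ⊗m assoc _ _ _)) -pentagon.
rewrite (cmpA (associ _ _ _)) assocK cmp1m assocK cmpm1.
by rewrite -tensm1 -assoc_nat cmpA lunit_tens rtensmM.
Qed.

(** The unit of the adjunction between [X ⊗ -] and [D ⊗ -], whose counit is
    [tens_pairing ev]. *)
Definition tens_unit (X D : B) (coev : Mor unitob (D ⊗ X)) (T : B) :
    Mor T (D ⊗ (X ⊗ T)) :=
  assoc D X T ∘ (coev ⊗m idm T) ∘ luniti T.

Lemma tens_unit_natural (X D : B) (coev : Mor unitob (D ⊗ X)) (T T' : B)
    (v : Mor T T') :
  (idm D ⊗m (idm X ⊗m v)) ∘ tens_unit coev T = tens_unit coev T' ∘ v.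
Proof.
rewrite /tens_unit !cmpA -assoc_nat tensm1 -(cmpA (assoc _ _ _)) -tensm_lr.
by rewrite -!cmpA luniti_nat.
Qed.

Lemma triangle_inv (X Y : B) :
  associ X unitob Y ∘ (idm X ⊗m luniti Y) = runiti X ⊗m idm Y.
Proof.
rewrite -[RHS]cmp1m -(assocK X unitob Y) -(cmpA (associ _ _ _)).
congr (_ ∘ _); rewrite -[RHS]cmp1m -tensm1 -(lunitK Y) ltensmM.
rewrite -(cmpA (idm X ⊗m luniti Y)) (cmpA (idm X ⊗m lunit Y)) triangle.
by rewrite -rtensmM runitiK tensm1 cmpm1.
Qed.

Lemma luniti_tens (X Y : B) :
  associ unitob X Y ∘ luniti (X ⊗ Y) = luniti X ⊗m idm Y.
Proof.
rewrite -[RHS]cmp1m -(assocK unitob X Y) -(cmpA (associ _ _ _)).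
congr (_ ∘ _); rewrite -[RHS]cmp1m -(lunitK (X ⊗ Y)).
rewrite -(cmpA (luniti _)) (cmpA (lunit (X ⊗ Y))) lunit_tens.
by rewrite -rtensmM lunitiK tensm1 cmpm1.
Qed.

(** Each of the two triangle identities of the adjunction is one of the
    zig-zags of duality, tensored with an object. *)
Lemma tens_pairing_unitK (X D : B) (ev : Mor (X ⊗ D) unitob)
    (coev : Mor unitob (D ⊗ X)) (T : B) :
  lunit X ∘ (ev ⊗m idm X) ∘ associ X D X ∘ (idm X ⊗m coev) ∘ runiti X
    = idm X ->
  tens_pairing ev (X ⊗ T) ∘ (idm X ⊗m tens_unit coev T) = idm (X ⊗ T).
Proof.
move=> zig; rewrite /tens_unit -cmpA ltensmM cmpA tens_pairing_tens ltensmM.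
rewrite -!cmpA (cmpA (associ _ _ _)) associ_nat -cmpA triangle_inv.
by rewrite -!rtensmM /tens_pairing !cmpA zig tensm1.
Qed.

Lemma tens_unit_pairingK (X D : B) (ev : Mor (X ⊗ D) unitob)
    (coev : Mor unitob (D ⊗ X)) (W : B) :
  runit D ∘ (idm D ⊗m ev) ∘ assoc D X D ∘ (coev ⊗m idm D) ∘ luniti D
    = idm D ->
  (idm D ⊗m tens_pairing ev W) ∘ tens_unit coev (D ⊗ W) = idm (D ⊗ W).
Proof.
move=> zag.
have pairE : (idm D ⊗m tens_pairing ev W) ∘ assoc D X (D ⊗ W)
    = ((runit D ∘ (idm D ⊗m ev) ∘ assoc D X D) ⊗m idm W)
        ∘ associ (D ⊗ X) D W.
  apply: (@assoc_epi _ _ _); rewrite -[RHS]cmpA assocK cmpm1 -cmpA pentagon.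
  rewrite /tens_pairing !ltensmM -!cmpA (cmpA (idm D ⊗m associ _ _ _)).
  rewrite -ltensmM assocK tensm1 cmp1m (cmpA (idm D ⊗m (ev ⊗m _))) -assoc_nat.
  by rewrite !cmpA triangle -!rtensmM.
rewrite /tens_unit !cmpA pairE -tensm1 -!cmpA (cmpA (associ _ _ _)).
by rewrite associ_nat -cmpA luniti_tens -!rtensmM !cmpA zag.
Qed.

Lemma dual_tens_ihom (X D : B) (ev : Mor (X ⊗ D) unitob)
    (coev : Mor unitob (D ⊗ X)) (W : B) :
  is_right_dual ev coev -> is_ihom (tens_pairing ev W).
Proof.
move=> [zig zag] T u; exists ((idm D ⊗m u) ∘ tens_unit coev T); split=> [|v <-].
  by rewrite ltensmM cmpA tens_pairing_natural -cmpA tens_pairing_unitK ?cmpm1.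
rewrite ltensmM -cmpA tens_unit_natural cmpA.
by rewrite tens_unit_pairingK ?cmp1m.
Qed.

Lemma dual_ihom (X D : B) (ev : Mor (X ⊗ D) unitob)
    (coev : Mor unitob (D ⊗ X)) :
  is_right_dual ev coev -> is_ihom ev.
Proof.
move=> dual T u; have [v [ev_v v_uniq]] := dual_tens_ihom (W := unitob) dual u.
exists (runit D ∘ v); split=> [|w ev_w].
  by rewrite ltensmM cmpA -tens_pairing_unit.
rewrite (v_uniq (runiti D ∘ w)); first by rewrite cmpA runitiK cmp1m.
by rewrite tens_pairing_unit -cmpA -ltensmM cmpA runitiK cmp1m.
Qed.

(** When [D] is the internal hom from [X] to the unit, one zig-zag suffices:
    both sides of the other are morphisms into [D], and they agree after
    pairing with [X]. *)
Lemma ihom_dual (X D : B) (ev : Mor (X ⊗ D) unitob)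
    (coev : Mor unitob (D ⊗ X)) :
  is_ihom ev -> tens_pairing ev X ∘ (idm X ⊗m coev) = runit X ->
  is_right_dual ev coev.
Proof.
move=> univ pair_coev.
have zig : lunit X ∘ (ev ⊗m idm X) ∘ associ X D X ∘ (idm X ⊗m coev) ∘ runiti X
    = idm X by rewrite -/(tens_pairing ev X) pair_coev runitiK.
split=> //; rewrite -!cmpA (cmpA (assoc _ _ _)) -/(tens_unit coev D).
apply: (ihom_inj univ).
rewrite (ltensmM _ (runit D)) (ltensmM _ (idm D ⊗m ev)) cmpA.
rewrite -tens_pairing_unit cmpA.
by rewrite tens_pairing_natural -cmpA tens_pairing_unitK // tensm1.
Qed.

(** * Exactness of the internal hom in its first argument *)

(** [fs] is the morphism of internal homs induced by [f], contravariantly. *)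
Definition is_ihom_map (X Y W HX HY : B) (eX : Mor (X ⊗ HX) W)
    (eY : Mor (Y ⊗ HY) W) (f : Mor X Y) (fs : Mor HY HX) : Prop :=
  eX ∘ (idm X ⊗m fs) = eY ∘ (f ⊗m idm HY).

Lemma ihom_map_exists (X Y W HX HY : B) (eX : Mor (X ⊗ HX) W)
    (eY : Mor (Y ⊗ HY) W) (f : Mor X Y) :
  is_ihom eX -> exists fs : Mor HY HX, is_ihom_map eX eY f fs.
Proof.
by move=> univ; have [fs [efs _]] := univ _ (eY ∘ (f ⊗m idm HY)); exists fs.
Qed.

Lemma ihom_map_cmp (X Y W HX HY T : B) (eX : Mor (X ⊗ HX) W)
    (eY : Mor (Y ⊗ HY) W) (f : Mor X Y) (fs : Mor HY HX) (t : Mor T HY) :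
  is_ihom_map eX eY f fs ->
  eX ∘ (idm X ⊗m (fs ∘ t)) = eY ∘ (idm Y ⊗m t) ∘ (f ⊗m idm T).
Proof. by move=> efs; rewrite ltensmM cmpA efs -!cmpA tensm_lr. Qed.

Hypothesis rexB : right_exact_tensor B.

Lemma rtens_cokernel (T U V W : B) (f : Mor U V) (g : Mor V W) :
  is_cokernel g f -> is_cokernel (g ⊗m idm T) (f ⊗m idm T).
Proof. exact: (rexB T).2.2. Qed.

Lemma ltens_cokernel (T U V W : B) (f : Mor U V) (g : Mor V W) :
  is_cokernel g f -> is_cokernel (idm T ⊗m g) (idm T ⊗m f).
Proof. exact: (rexB T).1.2. Qed.

Lemma ltens0 (T U V : B) : idm T ⊗m (0 : Mor U V) = 0.
Proof.
by apply: (addIr (idm T ⊗m (0 : Mor U V))); rewrite -[LHS](rexB T).1.1 /= !add0r.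
Qed.

Section ShortExact.
Variables (X Y Z : B) (f : Mor X Y) (g : Mor Y Z).

(** [Hom(T, [-, W])] is [Hom(- ⊗ T, W)], and [- ⊗ T] preserves cokernels. *)
Lemma ihom_left_exact (W HX HY HZ : B) (eX : Mor (X ⊗ HX) W)
    (eY : Mor (Y ⊗ HY) W) (eZ : Mor (Z ⊗ HZ) W)
    (fs : Mor HY HX) (gs : Mor HZ HY) :
  is_cokernel g f -> is_ihom eX -> is_ihom eY -> is_ihom eZ ->
  is_ihom_map eX eY f fs -> is_ihom_map eY eZ g gs -> is_kernel gs fs.
Proof.
move=> cok_g univX univY univZ efs egs; split=> [|T t fst0].
  apply: (ihom_inj univX); rewrite (ihom_map_cmp _ efs) egs ltens0 cmpm0 -cmpA.
  by rewrite (rtens_cokernel _ cok_g).1 cmpm0.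
have [|w [ew _]] := (rtens_cokernel T cok_g).2 _ (eY ∘ (idm Y ⊗m t)).
  by rewrite -(ihom_map_cmp _ efs) fst0 ltens0 cmpm0.
have [s [es s_uniq]] := univZ _ w.
exists s; split=> [|s' es'].
  by apply: (ihom_inj univY); rewrite (ihom_map_cmp _ egs) es.
apply/s_uniq/(cokernel_epi (rtens_cokernel T cok_g)).
by rewrite ew -(ihom_map_cmp _ egs) es'.
Qed.

Hypotheses (abB : is_abelian B) (fg : short_exact f g).
Hypothesis rigidZ : right_rigid Z.

(** With [D] the dual of [Z], the unit [P_i -> D ⊗ (Z ⊗ P_i)] lifts along the
    epimorphism [D ⊗ (Y ⊗ P_i) -> D ⊗ (Z ⊗ P_i)] at a lower index [k]. By
    adjunction this is a section of [g ⊗ P_i] over [Z ⊗ P_k]; subtracting it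
    projects [Y ⊗ P_k] onto [X ⊗ P_i], the kernel of [g ⊗ P_i]. *)
Lemma pro_retraction (P : inverse_system B)
    (flatP : forall i : idx P, left_flat (P i))
    (exP : ab_exact (colim_functor P)) (i : idx P) :
  exists (k : idx P) (ki : (k <= i)%O) (r : Mor (Y ⊗ P k) (X ⊗ P i)),
    r ∘ (f ⊗m idm (P k)) = idm X ⊗m sysmap ki.
Proof.
have [D [ev [coev [zig _]]]] := rigidZ.
have epi_Dg := cokernel_epi
  (ltens_cokernel D (rtens_cokernel (P i) fg.2)).
have [k [ki [s es]]] := pro_lift abB exP (tens_unit coev (P i)) epi_Dg.
exists k, ki; pose p := sysmap ki.
pose s' := tens_pairing ev (Y ⊗ P i) ∘ (idm Z ⊗m s).
have gs' : (g ⊗m idm (P i)) ∘ s' = idm Z ⊗m p.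
  rewrite /s' cmpA -tens_pairing_natural -cmpA -ltensmM es ltensmM cmpA.
  by rewrite tens_pairing_unitK // cmp1m.
have ker_f : is_kernel (f ⊗m idm (P i)) (g ⊗m idm (P i)).
  exact: ((flatP i).2 _ _ _ _ _ fg).1.
have [|r [er _]] := ker_f.2 _ ((idm Y ⊗m p) - s' ∘ (g ⊗m idm (P k))).
  by rewrite cmpmB cmpA gs' tensm_lr subrr.
exists r; apply: (kernel_mono ker_f); rewrite cmpA er cmpBm -cmpA.
by rewrite (rtens_cokernel _ fg.2).1 cmpm0 subr0 tensm_lr.
Qed.

Variables (S : Type) (P : S -> inverse_system B).
Hypothesis flatP : forall (a : S) (i : idx (P a)), left_flat (P a i).
Hypothesis exP : forall a : S, ab_exact (colim_functor (P a)).
Hypothesis faithful : jointly_faithful (fun a : S => colim_functor (P a)).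

(** A morphism from [P_i] to the internal hom from [X] to [W] is a morphism
    [X ⊗ P_i -> W]; composed with the retraction, it extends to [Y ⊗ P_k]. *)
Lemma ihom_map_epi (W HX HY : B) (eX : Mor (X ⊗ HX) W) (eY : Mor (Y ⊗ HY) W)
    (fs : Mor HY HX) :
  is_ihom eX -> is_ihom eY -> is_ihom_map eX eY f fs -> epi fs.
Proof.
move=> univX univY efs; apply: (pro_lift_epi faithful) => a i t.
have [k [ki [r rf]]] := pro_retraction (@flatP a) (exP a) i.
have [t' [et' _]] := univY _ (eX ∘ (idm X ⊗m t) ∘ r).
exists k, ki, t'; apply: (ihom_inj univX).
by rewrite (ihom_map_cmp _ efs) et' -cmpA rf ltensmM cmpA.
Qed.

Lemma ihom_exact (W HX HY HZ : B) (eX : Mor (X ⊗ HX) W)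
    (eY : Mor (Y ⊗ HY) W) (eZ : Mor (Z ⊗ HZ) W)
    (fs : Mor HY HX) (gs : Mor HZ HY) :
  is_ihom eX -> is_ihom eY -> is_ihom eZ ->
  is_ihom_map eX eY f fs -> is_ihom_map eY eZ g gs -> short_exact gs fs.
Proof.
move=> univX univY univZ efs egs.
have ker_gs := ihom_left_exact fg.2 univX univY univZ efs egs.
by split=> //; apply: epi_cokernel_of_kernel (ihom_map_epi univX univY efs) _.
Qed.

End ShortExact.

End MonoidalLemmas.

(** * Extensions of rigid objects *)

Theorem propositionC3 (B : monoidal)
  (abB : is_abelian B)
  (rexB : right_exact_tensor B)
  (internal_hom : forall X Z : B, exists H : B, represents_hom_tensor X Z H)
  (enough_flat : forall X : B, exists (P : B) (q : Mor P X),
     left_flat P /\ epi q)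
  (pro_systems : exists (S : Type) (P : S -> inverse_system B),
     [/\ forall (a : S) (i : idx (P a)), left_flat (P a i),
         forall a : S, ab_exact (colim_functor (P a))
       & jointly_faithful (fun a : S => colim_functor (P a))])
  (X Y Z : B) (f : Mor X Y) (g : Mor Y Z) (fg : short_exact f g)
  (rigidX : right_rigid X) (rigidZ : right_rigid Z) :
  right_rigid Y.
Proof.
have [S [P [flatP exP faithful]]] := pro_systems.
have exact_ihom := ihom_exact rexB abB fg rigidZ flatP exP faithful.
have [DX [evX [coevX dualX]]] := rigidX.
have [DZ [evZ [coevZ dualZ]]] := rigidZ.
(* The internal homs from [X] and [Z] to [unitob] and to [Y] are taken to be
   [DX], [DX ⊗ Y], [DZ] and [DZ ⊗ Y], so that the comparison morphisms for [X]
   and [Z] are identities. *)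
have uX := dual_ihom dualX; have uXY := dual_tens_ihom (W := Y) dualX.
have uZ := dual_ihom dualZ; have uZY := dual_tens_ihom (W := Y) dualZ.
have [D repD] := internal_hom Y unitob; have [ev univD] := represents_ihom repD.
have [E repE] := internal_hom Y Y; have [e univE] := represents_ihom repE.
have [fs efs] := ihom_map_exists ev f uX.
have [gs egs] := ihom_map_exists evZ g univD.
have [fs' efs'] := ihom_map_exists e f uXY.
have [gs' egs'] := ihom_map_exists (tens_pairing evZ Y) g univE.
have [_ cok_fs] := exact_ihom _ _ _ _ _ _ _ _ _ uX univD uZ efs egs.
have ex' := exact_ihom _ _ _ _ _ _ _ _ _ uXY univE uZY efs' egs'.
(* The comparison morphism [t : D ⊗ Y -> E] for [Y]. *)
have [t [et _]] := univE _ (tens_pairing ev Y).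
have [s ts] : exists s, t ∘ s = idm E.
  apply: (short_five abB (rtens_cokernel rexB Y cok_fs) ex').
  - apply: (ihom_inj univE); rewrite ltensmM cmpA et egs'.
    by rewrite -tens_pairing_cmpr egs tens_pairing_cmpl.
  - apply: (ihom_inj uXY); rewrite (ihom_map_cmp _ efs') et.
    by rewrite -tens_pairing_cmpr efs tens_pairing_cmpl.
(* [c] is the name of the identity of [Y]. *)
have [c [ec _]] := univE _ (runit Y).
exists D, ev, (s ∘ c); apply: ihom_dual => //.
by rewrite -et -cmpA -ltensmM cmpA ts cmp1m.
Qed.
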